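(* Let $q$ be an odd prime power, $\mathbb{F}_q$ the field with $q$ elements, and $\nu\ge 1$ an integer. Let ${\sf K}_\nu$ be the set of $\nu\times\nu$ alternate matrices over $\mathbb{F}_q$ (i.e. $X^t=-X$). For $i\in\{1,2\}$ with $i\le \nu$, let $\mathcal{O}_i$ be the group of all matrices in $GL_\nu(\mathbb{F}_q)$ of the form $\begin{pmatrix}T_{11}&0\\ T_{21}&T_{22}\end{pmatrix}$ with $T_{11}\in GL_i(\mathbb{F}_q)$, $T_{21}\in M_{\nu-i,i}(\mathbb{F}_q)$, $T_{22}\in GL_{\nu-i}(\mathbb{F}_q)$, acting on ${\sf K}_\nu$ by $(X,T)\mapsto T^tXT$. ($\{0\}$ is an orbit.) (i) Every nonzero $X\in{\sf K}_\nu$ lies in the $\mathcal{O}_1$-orbit of exactly one of the matrices $[0,\mathcal{A}_{2r},0^{(\nu-2r-1)}]$ $(1\le r\le\lfloor(\nu-1)/2\rfloor)$ and $[\mathcal{A}_{2r},0^{(\nu-2r)}]$ $(1\le r\le\lfloor\nu/2\rfloor)$, and these matrices lie in pairwise distinct orbits. (ii) Assume $\nu\ge2$. Every nonzero $X\in{\sf K}_\nu$ lies in the $\mathcal{O}_2$-orbit of exactly one of the matrices $[0,\mathcal{A}_{2r},0^{(\nu-2r-1)}]$ $(1\le r\le\lfloor(\nu-1)/2\rfloor)$, $[0^{(2)},\mathcal{A}_{2r},0^{(\nu-2r-2)}]$ $(1\le r\le\lfloor(\nu-2)/2\rfloor)$, $[\mathcal{A}_{2r},0^{(\nu-2r)}]$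 $(1\le r\le\lfloor\nu/2\rfloor)$, $[\mathcal{K},\mathcal{A}_{2r-4},0^{(\nu-2r)}]$ $(2\le r\le\lfloor\nu/2\rfloor)$, where $\mathcal{K}=\begin{pmatrix}0&I^{(2)}\\-I^{(2)}&0\end{pmatrix}$; and these matrices lie in pairwise distinct orbits.
   Context: $[X_1,\dots,X_t]$ denotes the block diagonal matrix with diagonal blocks $X_1,\dots,X_t$ (blocks of size $0$ are omitted). $0^{(p)}$ is the $p\times p$ zero matrix and $0$ alone denotes the $1\times1$ zero block. $\mathcal{A}_2=\begin{pmatrix}0&1\\-1&0\end{pmatrix}$ and $\mathcal{A}_{2r}=[\mathcal{A}_2,\dots,\mathcal{A}_2]$ ($r$ copies), a $2r\times 2r$ matrix; $\mathcal{A}_0$ is empty. $I^{(m)}$ is the $m\times m$ identity matrix. *)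

(* Defs.v *)
From HB Require Import structures.
From mathcomp Require Import all_boot all_order all_algebra all_fingroup.

Set Implicit Arguments.
Unset Strict Implicit.
Unset Printing Implicit Defensive.

Import GRing.Theory.
Local Open Scope ring_scope.

Section Blocks.
Variable F : fieldType.

(* [X, Y], the block diagonal matrix with blocks X and Y. *)
Definition diag2 m n (X : 'M[F]_m) (Y : 'M[F]_n) : 'M[F]_(m + n) :=
  block_mx X 0 0 Y.

(* skew_mx 1 is A_2 and skew_mx 2 is the 4 x 4 block K. *)
Definition skew_mx m : 'M[F]_(m + m) := block_mx 0 1%:M (- 1%:M) 0.

(* A_{2r}; its size is 2r, in the form of a sum of r copies of 2. *)
Definition calA r : 'M[F]_(\sum_(i < r) 2) := \mxdiag_(i < r) (skew_mx 1).

(* The sizes of the blocks below add up to nu for every r in the ranges used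
   in reps1 and reps2, so conform_mx only transports along that equality. *)

(* [A_{2r}, 0^(nu - 2r)] *)
Definition repA nu r : 'M[F]_nu :=
  conform_mx 0 (diag2 (calA r) (0 : 'M_(nu - 2 * r))).

(* [0^(p), A_{2r}, 0^(nu - 2r - p)] *)
Definition repZ p nu r : 'M[F]_nu :=
  conform_mx 0
    (diag2 (0 : 'M_p) (diag2 (calA r) (0 : 'M_(nu - 2 * r - p)))).

(* [K, A_{2r - 4}, 0^(nu - 2r)] *)
Definition repK nu r : 'M[F]_nu :=
  conform_mx 0
    (diag2 (skew_mx 2) (diag2 (calA (r - 2)) (0 : 'M_(nu - 2 * r)))).

(* index_iota a b.+1 lists the r with a <= r <= b. *)
Definition reps1 nu : seq 'M[F]_nu :=
  [seq repZ 1 nu r | r <- index_iota 1 ((nu - 1) %/ 2).+1] ++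
  [seq repA nu r | r <- index_iota 1 (nu %/ 2).+1].

Definition reps2 nu : seq 'M[F]_nu :=
  [seq repZ 1 nu r | r <- index_iota 1 ((nu - 1) %/ 2).+1] ++
  [seq repZ 2 nu r | r <- index_iota 1 ((nu - 2) %/ 2).+1] ++
  [seq repA nu r | r <- index_iota 1 (nu %/ 2).+1] ++
  [seq repK nu r | r <- index_iota 2 (nu %/ 2).+1].

End Blocks.

Section Action.
Variable F : finFieldType.

Definition alternate_mxs nu : {set 'M[F]_nu} := [set X | X^T == - X].

(* MathComp's {'GL_nu[F]} consists of matrices of size nu.-1.+1, so nu >= 1 is
   written n.+1 below. *)
Definition congr_mx n (X : 'M[F]_n.+1) (T : {'GL_n.+1[F]}) : 'M[F]_n.+1 :=
  (GLval T)^T *m X *m GLval T.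

Fact congr_mx_is_action n : is_action [set: {'GL_n.+1[F]}] (@congr_mx n).
Proof.
apply: is_total_action => [X | X S T]; rewrite /congr_mx.
  by rewrite GL_1E trmx1 mul1mx mulmx1.
by rewrite GL_MxE trmx_mul !mulmxA.
Qed.

Canonical congr_action n := Action (@congr_mx_is_action n).

Definition lower_block i n (le_i_n : (i <= n.+1)%N) (T11 : 'M[F]_i)
    (T21 : 'M[F]_(n.+1 - i, i)) (T22 : 'M[F]_(n.+1 - i)) : 'M[F]_n.+1 :=
  castmx (subnKC le_i_n, subnKC le_i_n) (block_mx T11 0 T21 T22).

Definition O_ i n (le_i_n : (i <= n.+1)%N) : {set {'GL_n.+1[F]}} :=
  [set T : {'GL_n.+1[F]} | [exists T11, exists T21, exists T22,
    [&& T11 \in unitmx, T22 \in unitmx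
      & GLval T == lower_block le_i_n T11 T21 T22]]].

Lemma O_group_set i n (le_i_n : (i <= n.+1)%N) : group_set (O_ le_i_n).
Proof.
have OP (T : {'GL_n.+1[F]}) : reflect (exists T11 T21 T22,
    [/\ T11 \in unitmx, T22 \in unitmx & GLval T = lower_block le_i_n T11 T21 T22]) (T \in O_ le_i_n).
  rewrite inE; apply: (iffP existsP) => -[T11].
    by case/existsP=> T21 /existsP[T22 /and3P[? ? /eqP ?]]; exists T11, T21, T22.
  move=> [T21 [T22 [U1 U2 ->]]]; exists T11; apply/existsP; exists T21.
  by apply/existsP; exists T22; rewrite U1 U2 eqxx.
apply/group_setP; split=> [|S T].
  apply/OP; exists 1%:M, 0, 1%:M; split; rewrite ?unitmx1 // GL_1E.
  rewrite /lower_block -scalar_mx_block; move: (subnKC le_i_n).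
  by move=> e; apply/matrixP=> a b; rewrite castmxE !mxE.
case/OP=> [S11 [S21 [S22 [U1 U2 eS]]]] /OP[T11 [T21 [T22 [V1 V2 eT]]]].
apply/OP; exists (S11 *m T11), (S21 *m T11 + S22 *m T21), (S22 *m T22).
split; rewrite ?unitmx_mul ?U1 ?U2 // GL_MxE eS eT /lower_block.
set A := block_mx S11 _ _ _; set B := block_mx T11 _ _ _.
have <- : A *m B
    = block_mx (S11 *m T11) 0 (S21 *m T11 + S22 *m T21) (S22 *m T22).
  by rewrite mulmx_block !(mul0mx, mulmx0, addr0, add0r).
have castM k m (e : k = m) (C D : 'M[F]_k) :
    castmx (e, e) C *m castmx (e, e) D = castmx (e, e) (C *m D).
  by case: _ / e; rewrite !castmx_id.
exact: castM.
Qed.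

Canonical O_group i n (le_i_n : (i <= n.+1)%N) := Group (O_group_set le_i_n).


End Action.

(* Main.v *)
Require Import Defs.
From HB Require Import structures.
From mathcomp Require Import all_boot all_order all_algebra all_fingroup.
From mathcomp Require Import cyclic zify.
Set Implicit Arguments.
Unset Strict Implicit.
Unset Printing Implicit Defensive.
Import GRing.Theory.
Local Open Scope ring_scope.

(* T acts on column vectors and O_i is the stabilizer of the subspace W of
   vectors whose first i coordinates vanish.  Hence the rank of the form X, the
   rank of its pairing of W with the whole space, and the rank of its
   restriction to W are invariants.  For i <= 2 they are complete: a hyperbolic
   plane can be split off inside W as long as X does not vanish on W; once W is
   totally isotropic, only the pairing C of W with a complement and the i x i
   form D on that complement remain, and either C = 0, or D can be given any
   alternate value by changing the complement.  The ranks of an alternate form are even,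
   and equality of the first two ranks forces equality of all three (W then
   meets every coset of the radical), which leaves only the triples attained by
   the listed representatives. *)

(** * Generalities: lists without repetition, transport along equalities of sizes *)

Lemma uniq_map_inj_in (T1 T2 : eqType) (f : T1 -> T2) (s : seq T1) :
  uniq (map f s) -> {in s &, injective f}.
Proof.
move=> us x y xs ys fxy; rewrite -(nth_index x xs) -(nth_index x ys).
congr nth; apply/eqP; rewrite -(nth_uniq (f x) _ _ us) ?size_map ?index_mem //.
by rewrite !(nth_map x) ?index_mem // !nth_index // fxy.
Qed.

Lemma cast_congr (R : comNzRingType) m n (e : m = n) (X : 'M[R]_n) (T : 'M_m) :
  castmx (esym e, esym e) ((castmx (e, e) T)^T *m X *m castmx (e, e) T)
    = T^T *m castmx (esym e, esym e) X *m T.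
Proof. by case: n / e X => X; rewrite !castmx_id. Qed.

Lemma cast_unit (R : comUnitRingType) m n (e : m = n) (T : 'M[R]_m) :
  (castmx (e, e) T \in unitmx) = (T \in unitmx).
Proof. by case: n / e; rewrite castmx_id. Qed.

Lemma cast_skew (R : pzRingType) m n (e : m = n) (X : 'M[R]_m) :
  X^T = - X -> (castmx (e, e) X)^T = - castmx (e, e) X.
Proof. by case: n / e; rewrite !castmx_id. Qed.

(** * Alternate forms in characteristic different from 2: splitting and parity of the rank *)

Section SkewForms.
Variable F : fieldType.
Hypothesis two_neq0 : 2%:R != 0 :> F.

Lemma skew_congr m n (X : 'M[F]_m) (T : 'M_(m, n)) :
  X^T = - X -> (T^T *m X *m T)^T = - (T^T *m X *m T).
Proof. by move=> skX; rewrite !trmx_mul trmxK skX mulNmx mulmxN mulmxA. Qed.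

Lemma rank_congr m (X T : 'M[F]_m) :
  T \in unitmx -> \rank (T^T *m X *m T) = \rank X.
Proof.
move=> Tu; rewrite mxrankMfree ?row_free_unit // -mxrank_tr trmx_mul trmxK.
by rewrite mxrankMfree ?row_free_unit // mxrank_tr.
Qed.

(** A diagonal entry equals its own opposite. All uses of the characteristic go through this
    fact. *)
Lemma skew_diag0 m (X : 'M[F]_m) k : X^T = - X -> X k k = 0.
Proof.
move/matrixP/(_ k k); rewrite !mxE => /eqP; rewrite -addr_eq0 -mulr2n.
by rewrite -mulr_natl mulf_eq0 (negPf two_neq0) => /eqP.
Qed.

Lemma skew_mx_skew m : (skew_mx F m)^T = - skew_mx F m.
Proof.
by rewrite /skew_mx tr_block_mx opp_block_mx linearN /= trmx1 !trmx0 oppr0 opprK.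
Qed.

Lemma skew_mx_sqr m : skew_mx F m *m skew_mx F m = - 1%:M.
Proof.
rewrite /skew_mx mulmx_block scalar_mx_block opp_block_mx.
by rewrite !(mul0mx, mulmx0, mul1mx, mulmx1, add0r, addr0, oppr0).
Qed.

Lemma skew_mx_unit m : skew_mx F m \in unitmx.
Proof.
have /mulmx1_unit[] // : skew_mx F m *m - skew_mx F m = 1%:M.
by rewrite mulmxN skew_mx_sqr opprK.
Qed.

Lemma skew2E (A : 'M[F]_(1 + 1)) : A^T = - A -> A = A 0 1 *: skew_mx F 1.
Proof.
move=> skA; apply/matrixP=> a b; rewrite mxE.
have Aab : A a b = - A b a by have /matrixP/(_ b a) := skA; rewrite !mxE.
case: (eqVneq a b) => [-> | ab].
  by rewrite !skew_diag0 ?mulr0 //; apply: skew_mx_skew.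
have [[-> ->] | [ea eb]] : a = 0 /\ b = 1 \/ a = 1 /\ b = 0.
  case: a b ab {Aab} => [[|[|//]] a] [[|[|//]] b] // ab; [left|right];
    by split; apply: val_inj.
- have -> : skew_mx F 1 0 1 = 1; last by rewrite mulr1.
  have -> : 1 = rshift 1 0 :> 'I_(1 + 1) by apply: val_inj.
  have -> : 0 = lshift 1 0 :> 'I_(1 + 1) by apply: val_inj.
  by rewrite /skew_mx block_mxEur mxE.
rewrite Aab ea eb.
have -> : skew_mx F 1 1 0 = -1; last by rewrite mulrN1.
have -> : 1 = rshift 1 0 :> 'I_(1 + 1) by apply: val_inj.
have -> : 0 = lshift 1 0 :> 'I_(1 + 1) by apply: val_inj.
by rewrite /skew_mx block_mxEdl !mxE.
Qed.

Lemma skew_small0 m (A : 'M[F]_m) : (m <= 1)%N -> A^T = - A -> A = 0.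
Proof.
move=> m1 skA; apply/matrixP=> a b; rewrite mxE.
have -> : b = a by apply: val_inj => /=; have := ltn_ord a; have := ltn_ord b; lia.
exact: skew_diag0.
Qed.

Lemma skew2_congr (A B : 'M[F]_(1 + 1)) :
    A^T = - A -> B^T = - B -> A != 0 -> B != 0 ->
  exists2 U, U \in unitmx & U^T *m A *m U = B.
Proof.
move=> /skew2E-> /skew2E->; set a := A 0 1; set b := B 0 1.
rewrite !scaler_eq0 !negb_or => /andP[a0 _] /andP[b0 _].
(* In size 2 a congruence by U multiplies an alternate form by det U, so a diagonal U of determinant
   b / a suffices. *)
exists (block_mx 1%:M 0 0 (b / a)%:M : 'M_(1 + 1)).
  by rewrite unitmxE det_lblock det1 det_scalar1 mul1r unitfE mulf_neq0 ?invr_neq0.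
rewrite -scalemxAr -scalemxAl tr_block_mx !trmx0 trmx1 tr_scalar_mx.
rewrite /skew_mx !mulmx_block.
rewrite !(mul0mx, mulmx0, mul1mx, mulmx1, add0r, addr0, oppr0, mulNmx, mulmxN).
rewrite !scale_block_mx !scaler0; congr block_mx.
  by rewrite scale_scalar_mx mulrCA mulfV // mulr1 scalemx1.
by rewrite !scalerN scale_scalar_mx mulrCA mulfV // mulr1 scalemx1.
Qed.

Lemma perm_map2 n (p q : 'I_n.+2) : p != q ->
  exists s : 'S_n.+2, s 0 = p /\ s 1 = q.
Proof.
(* Products of permutations apply the left factor first. So 1 goes to t q and then to q, while 0 is
   fixed by the first factor (t q is nonzero as q differs from p) and then goes to p. *)
move=> pq; pose t := tperm 0 p; exists (mulg (tperm 1 (t q)) t); split; last first.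
  by rewrite permM tpermL tpermK.
rewrite permM (@tpermD _ 1 _ 0) ?tpermL // /t.
by rewrite -{2}(tpermR 0 p) (inj_eq perm_inj) eq_sym.
Qed.

(** Elimination with pivot J: its inverse is -J, so adding the columns of J times [J *m B] cancels
    B, and the Schur complement remains in the corner. *)
Lemma skew_clear p m (J : 'M[F]_p) (B : 'M_(p, m)) D :
    J^T = - J -> J *m J = - 1%:M ->
  (block_mx 1%:M (J *m B) 0 1%:M)^T *m block_mx J B (- B^T) D
    *m block_mx 1%:M (J *m B) 0 1%:M = block_mx J 0 0 (D - B^T *m J *m B).
Proof.
move=> skJ J2; rewrite tr_block_mx !trmx1 trmx0 trmx_mul skJ mulmxN !mulmx_block.
rewrite !(mul0mx, mulmx0, mul1mx, mulmx1, add0r, addr0) mulNmx.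
rewrite -[_ *m J *m J]mulmxA J2 mulmxN mulmx1 opprK addrN mul0mx add0r.
by rewrite mulmxA J2 mulNmx mul1mx addNr mulNmx addrC.
Qed.

(** A permutation of the coordinates brings a nonzero entry to position (0, 1). The leading 2 x 2
    block is then nonzero, can be normalized to [skew_mx 1], and serves as pivot in [skew_clear]. *)
Lemma skew_split m (Z : 'M[F]_(2 + m)) : Z^T = - Z -> Z != 0 ->
  exists2 T, T \in unitmx &
    exists2 Z1, Z1^T = - Z1 & T^T *m Z *m T = block_mx (skew_mx F 1) 0 0 Z1.
Proof.
move=> skZ Z0.
have [p [q Zpq]] : exists p q, Z p q != 0.
  case: (pickP (fun k => Z k.1 k.2 != 0)) => [[p q] Zpq | Zall0]; first by exists p, q.
  case/eqP: Z0; apply/matrixP=> p q; rewrite mxE.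
  by apply/eqP/negbFE; apply: (Zall0 (p, q)).
have pq : p != q by apply: contraNneq Zpq => ->; rewrite skew_diag0.
have [s [s0 s1]] := perm_map2 pq.
pose Q : 'M[F]_(2 + m) := (perm_mx s)^T.
have [Y defY] : exists Y, Y = Q^T *m Z *m Q by eexists.
have Yent a b : Y a b = Z (s a) (s b).
  by rewrite defY /Q trmxK tr_perm_mx -row_permE -col_permE !mxE.
have skY : Y^T = - Y by rewrite defY; apply: skew_congr.
have skA : (ulsubmx Y)^T = - ulsubmx Y.
  by rewrite trmx_ulsub skY; apply/matrixP=> a b; rewrite !mxE.
have A0 : ulsubmx Y != 0.
  apply: contraNneq Zpq => /matrixP/(_ 0 1); rewrite !mxE Yent.
  have -> : lshift m (0 : 'I_2) = (0 : 'I_m.+2) by apply: val_inj.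
  have -> : lshift m (1 : 'I_2) = (1 : 'I_m.+2) by apply: val_inj.
  by rewrite s0 s1 => ->.
have J0 : skew_mx F 1 != 0 :> 'M_2.
  by apply: contraTneq (skew_mx_unit 1) => ->; rewrite unitmxE det0 unitr0.
have [U Uu UA] := skew2_congr skA (skew_mx_skew 1) A0 J0.
pose B := U^T *m ursubmx Y.
pose T : 'M_(2 + m) := Q *m block_mx U 0 0 1%:M
  *m block_mx 1%:M (skew_mx F 1 *m B) 0 1%:M.
have Tu : T \in unitmx.
  rewrite !unitmx_mul unitmx_tr unitmx_perm /= !unitmxE det_lblock det_ublock.
  by rewrite !det1 !mulr1 unitr1 andbT -unitmxE.
exists T => //.
have YE : Y = block_mx (ulsubmx Y) (ursubmx Y) (- (ursubmx Y)^T) (drsubmx Y).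
  rewrite -{1}[Y]submxK; congr block_mx.
  by rewrite trmx_ursub skY; apply/matrixP=> a b; rewrite !mxE opprK.
have [Z1 TZ] : exists Z1, T^T *m Z *m T = block_mx (skew_mx F 1) 0 0 Z1.
  have -> : T^T *m Z *m T = (block_mx 1%:M (skew_mx F 1 *m B) 0 1%:M)^T *m
     ((block_mx U 0 0 1%:M)^T *m Y *m block_mx U 0 0 1%:M) *m
     block_mx 1%:M (skew_mx F 1 *m B) 0 1%:M.
    by rewrite /T defY !trmx_mul !mulmxA.
  have -> : (block_mx U 0 0 1%:M)^T *m Y *m block_mx U 0 0 1%:M
      = block_mx (skew_mx F 1) B (- B^T) (drsubmx Y).
    rewrite {1}YE tr_block_mx !trmx0 trmx1 !mulmx_block.
    rewrite !(mul0mx, mulmx0, mul1mx, mulmx1, add0r, addr0) UA.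
    by rewrite mulNmx /B trmx_mul trmxK.
  by rewrite skew_clear ?skew_mx_skew ?skew_mx_sqr //; eexists.
exists Z1 => //.
have := skew_congr T skZ; rewrite TZ tr_block_mx opp_block_mx.
by case/eq_block_mx.
Qed.

Lemma skew_rank_even m (Z : 'M[F]_m) : Z^T = - Z -> ~~ odd (\rank Z).
Proof.
elim/ltn_ind: m Z => m IHm Z skZ.
have [-> | Z0] := eqVneq Z 0; first by rewrite mxrank0.
case: m => [|[|m]] in IHm Z skZ Z0 *; try by rewrite (skew_small0 _ skZ) ?mxrank0.
have [T Tu [Z1 skZ1 TZ]] := skew_split skZ Z0.
have -> : \rank Z = \rank (block_mx (skew_mx F 1) 0 0 Z1) by rewrite -TZ rank_congr.
rewrite rank_diag_block_mx mxrank_unit; last exact: skew_mx_unit.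
by rewrite oddD; apply: (IHm m) => //; lia.
Qed.

(** * Congruence under the stabilizer of W and invariance of the three ranks *)

(** This is the orbit relation of O_i in sizes of the form i + m. The diagonal blocks of T are
    invertible by [lower_unit]. *)
Definition pcongr i m (X Y : 'M[F]_(i + m)) := exists T,
  [/\ T \in unitmx, ursubmx T = 0 & T^T *m X *m T = Y].

Lemma pcongr_trans i m (Y X Z : 'M[F]_(i + m)) :
  pcongr X Y -> pcongr Y Z -> pcongr X Z.
Proof.
move=> [T [Tu T0 <-]] [S [Su S0 <-]]; exists (T *m S); split.
- by rewrite unitmx_mul Tu.
- rewrite -(submxK T) -(submxK S) T0 S0 mulmx_block block_mxKur.
  by rewrite mul0mx mulmx0 addr0.
- by rewrite trmx_mul !mulmxA.
Qed.

Lemma lower_unit i m (T : 'M[F]_(i + m)) : ursubmx T = 0 ->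
  (T \in unitmx) = (ulsubmx T \in unitmx) && (drsubmx T \in unitmx).
Proof.
move=> T0; rewrite -{1}(submxK T) T0 !unitmxE det_lblock !unitfE.
by rewrite mulf_eq0 negb_or.
Qed.

Lemma pcongr_sym i m (X Y : 'M[F]_(i + m)) : pcongr X Y -> pcongr Y X.
Proof.
move=> [T [Tu T0 <-]]; exists (invmx T); split; first by rewrite unitmx_inv.
  (* The upper right block of [T *m invmx T = 1%:M] says that the invertible block [ulsubmx T] kills
     the upper right block of the inverse. *)
  have := mulmxV Tu; rewrite -{1}(submxK T) -{1}(submxK (invmx T)) T0 mulmx_block.
  rewrite scalar_mx_block => /eq_block_mx[_ + _ _].
  rewrite mul0mx addr0 => TS0; move: Tu; rewrite lower_unit // => /andP[Au _].
  by rewrite -(mulKmx Au (ursubmx _)) TS0 mulmx0.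
by rewrite trmx_inv -!mulmxA mulmxV // mulmx1 mulKmx // unitmx_tr.
Qed.

Lemma pcongr_lower i m (X : 'M[F]_(i + m)) A B C : A \in unitmx -> C \in unitmx ->
  pcongr X ((block_mx A 0 B C)^T *m X *m block_mx A 0 B C).
Proof.
move=> Au Cu; exists (block_mx A 0 B C); split; rewrite ?block_mxKur //.
by rewrite lower_unit ?block_mxKul ?block_mxKdr ?block_mxKur ?Au.
Qed.

Lemma pcongr_skew i m (X Y : 'M[F]_(i + m)) : pcongr X Y -> X^T = - X -> Y^T = - Y.
Proof. by move=> [T [_ _ <-]]; apply: skew_congr. Qed.

(* copid_mx i is the projection onto W: its first i rows and columns are 0. *)
Definition wranks i n (X : 'M[F]_n) : nat * nat * nat :=
  (\rank X, \rank (copid_mx i *m X), \rank (copid_mx i *m X *m copid_mx i)).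

Lemma copid_block i m : copid_mx i = block_mx 0 0 0 1%:M :> 'M[F]_(i + m).
Proof.
rewrite /copid_mx pid_mx_block scalar_mx_block opp_block_mx add_block_mx.
by rewrite !oppr0 !addr0 subrr.
Qed.

Lemma tr_copid_mx i n : (copid_mx i)^T = copid_mx i :> 'M[F]_n.
Proof. by rewrite /copid_mx linearB /= trmx1 tr_pid_mx. Qed.

(** T maps W into itself, that is [T *m P = P *m T *m P] for the projection P onto W. Hence a P can
    be inserted next to X, and the last two ranks cannot increase from X to Y; symmetry of [pcongr]
    gives equality. *)
Lemma wranks_pcongr i m (X Y : 'M[F]_(i + m)) : pcongr X Y -> wranks i X = wranks i Y.
Proof.
have rank_le_mul k (A B C : 'M[F]_k) : (\rank (A *m B *m C) <= \rank B)%N.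
  by apply: leq_trans (mxrankM_maxl _ _) (mxrankM_maxr _ _).
have le_half (U V : 'M[F]_(i + m)) : pcongr U V ->
    (\rank (copid_mx i *m V) <= \rank (copid_mx i *m U))%N /\
    (\rank (copid_mx i *m V *m copid_mx i)
       <= \rank (copid_mx i *m U *m copid_mx i))%N.
  move=> [T [_ T0 <-]]; set P := copid_mx i.
  have TP : T *m P = P *m T *m P.
    rewrite /P copid_block -(submxK T) T0 !mulmx_block.
    by rewrite !(mul0mx, mulmx0, mul1mx, mulmx1, add0r, addr0).
  have PT : P *m T^T = P *m T^T *m P.
    by have := congr1 trmx TP; rewrite !trmx_mul tr_copid_mx mulmxA.
  rewrite !mulmxA PT -!mulmxA TP; split.
    by rewrite !mulmxA -(mulmxA _ P U); apply: rank_le_mul.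
  rewrite !mulmxA -(mulmxA (P *m T^T)) -(mulmxA (P *m T^T)) -(mulmxA _ T P).
  exact: rank_le_mul.
move=> XY; have [T [Tu _ TX]] := XY.
have [b1 c1] := le_half _ _ XY; have [b2 c2] := le_half _ _ (pcongr_sym XY).
rewrite /wranks -{1}TX rank_congr //.
by congr (_, _, _); apply/eqP; rewrite eqn_leq ?b1 ?b2 ?c1 ?c2.
Qed.

Lemma solve_skew_part i m (C : 'M[F]_(i, m)) D : (i <= 2)%N -> C != 0 -> D^T = - D ->
  exists E, C *m E - (C *m E)^T = D.
Proof.
move=> i2 C0 skD.
have [i1 | i_gt1] := leqP i 1.
  by exists 0; rewrite mulmx0 trmx0 subrr (skew_small0 i1 skD).
have [p [q Cpq]] : exists p q, C p q != 0.
  case: (pickP (fun k => C k.1 k.2 != 0)) => [[p q] Cpq | Call0]; first by exists p, q.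
  case/eqP: C0; apply/matrixP=> p q; rewrite mxE.
  by apply/eqP/negbFE; apply: (Call0 (p, q)).
(* Only row q of E is nonzero, and it makes row p of [C *m E] equal to row p of D. Column p of
   [C *m E] vanishes because D p p = 0, so the difference agrees with D in row and column p. As i <=
   2, at most one other entry is left, and it is diagonal. *)
exists (\matrix_(a, b) ((a == q)%:R * D p b / C p q)).
have CE a b : (C *m \matrix_(a, b) ((a == q)%:R * D p b / C p q)) a b
    = C a q * (D p b / C p q).
  rewrite mxE (bigD1 q) //= big1 ?addr0 => [|k /negPf kq]; rewrite mxE.
    by rewrite eqxx mul1r.
  by rewrite kq !mul0r mulr0.
have CEp b : C p q * (D p b / C p q) = D p b by rewrite mulrCA mulfV ?mulr1.
have Dpp : D p p = 0 by apply: skew_diag0.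
apply/matrixP=> a b; rewrite [LHS]mxE [X in _ + X]mxE [X in _ - X]mxE !CE.
have [-> | ap] := eqVneq a p; first by rewrite CEp Dpp mul0r mulr0 subr0.
have [-> | bp] := eqVneq b p.
  rewrite CEp Dpp mul0r mulr0 sub0r.
  by have /matrixP/(_ p a) := skD; rewrite !mxE => ->.
have -> : b = a.
  apply: val_inj => /=; have := ltn_ord a; have := ltn_ord b; have := ltn_ord p.
  by move: ap bp; rewrite -!val_eqE /=; lia.
by rewrite subrr skew_diag0.
Qed.

(** * Splitting off a hyperbolic plane inside W *)

Lemma rank_swap_row m1 m2 m3 n (A : 'M[F]_(m1, n)) (B : 'M_(m2, n)) (C : 'M_(m3, n)) :
  \rank (col_mx A (col_mx B C)) = \rank (col_mx B (col_mx A C)).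
Proof. rewrite -!addsmxE -(adds_eqmx (eqmx_refl A) (addsmxE B C)).
by rewrite -(adds_eqmx (eqmx_refl B) (addsmxE A C)) !addsmxA (addsmxC A). Qed.

Lemma rank_swap_col m n1 n2 n3 (A : 'M[F]_(m, n1)) (B : 'M_(m, n2)) (C : 'M_(m, n3)) :
  \rank (row_mx A (row_mx B C)) = \rank (row_mx B (row_mx A C)).
Proof. by rewrite -mxrank_tr !tr_row_mx rank_swap_row -!tr_row_mx mxrank_tr. Qed.

(** Moving the rows and columns of J to the front makes the matrix block diagonal. *)
Lemma rank_insert p1 p2 q1 q2 r (D : 'M[F]_(p1, p2)) (C : 'M_(p1, q2)) (E : 'M_(q1, p2))
    (Z : 'M_(q1, q2)) (J : 'M_r) :
  \rank (block_mx D (row_mx 0 C) (col_mx 0 E) (block_mx J 0 0 Z))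
    = (\rank J + \rank (block_mx D C E Z))%N.
Proof.
have -> : block_mx D (row_mx 0 C) (col_mx 0 E) (block_mx J 0 0 Z)
    = col_mx (row_mx D (row_mx 0 C))
        (col_mx (row_mx 0 (row_mx J 0)) (row_mx E (row_mx 0 Z))).
  rewrite [LHS]block_mxEv; congr col_mx.
  by rewrite [block_mx J _ _ _]block_mxEv -[LHS]block_mxEh [LHS]block_mxEv.
rewrite rank_swap_row -[col_mx (row_mx D _) _]block_mxEv block_mxEh.
have -> : col_mx (row_mx 0 C) (row_mx 0 Z) = row_mx 0 (col_mx C Z) :> 'M_(_, r + _).
  by rewrite -block_mxEv block_mxEh col_mx0.
rewrite -[col_mx (row_mx _ _) _]block_mxEv block_mxEh.
have -> : col_mx (row_mx J 0) (row_mx 0 (col_mx C Z))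
    = row_mx (col_mx J 0) (col_mx 0 (col_mx C Z)).
  by rewrite -block_mxEv block_mxEh.
rewrite rank_swap_col -[row_mx (col_mx 0 _) _]block_mxEh block_mxEv row_mx0.
by rewrite -block_mxEh rank_diag_block_mx block_mxEh.
Qed.

(** The orthogonal sum of X and a hyperbolic plane, placed after the first i coordinates so that the
    plane lies in W. *)
Definition insert_skew i m (X : 'M[F]_(i + m)) : 'M_(i + (2 + m)) :=
  block_mx (ulsubmx X) (row_mx 0 (ursubmx X)) (col_mx 0 (dlsubmx X))
    (block_mx (skew_mx F 1) 0 0 (drsubmx X)).

Lemma skew_blocks i m (X : 'M[F]_(i + m)) : X^T = - X ->
  [/\ (ulsubmx X)^T = - ulsubmx X, dlsubmx X = - (ursubmx X)^T
    & (drsubmx X)^T = - drsubmx X].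
Proof.
rewrite -(submxK X) block_mxKul block_mxKur block_mxKdl block_mxKdr.
rewrite tr_block_mx opp_block_mx => /eq_block_mx[-> _ -> ->].
by rewrite opprK.
Qed.

Lemma insert_skew_pcongr i m (X Y : 'M[F]_(i + m)) :
  pcongr X Y -> pcongr (insert_skew X) (insert_skew Y).
Proof.
move=> [T [Tu T0 <-]]; move: Tu; rewrite lower_unit // => /andP[Au Cu].
rewrite -(submxK T) T0 -{2}(submxK X).
move: (ulsubmx T) (dlsubmx T) (drsubmx T) Au Cu => A B C Au Cu.
have Cu' : block_mx 1%:M 0 0 C \in @unitmx F (2 + m).
  by rewrite unitmxE det_lblock det1 mul1r -unitmxE.
(* T is extended by the identity on the inserted plane. *)
have := pcongr_lower (insert_skew X) (col_mx 0 B) Au Cu'; congr pcongr.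
rewrite /insert_skew; move: (ulsubmx X) (ursubmx X) (dlsubmx X) (drsubmx X) => D U L Z.
rewrite !tr_block_mx !trmx1 !trmx0 tr_col_mx trmx0 !mulmx_block.
rewrite block_mxKul block_mxKur block_mxKdl block_mxKdr.
do 2!rewrite !(mul_row_block, mul_block_col, mul_mx_row, mul_col_mx, mulmx_block)
  ?(add_row_mx, add_col_mx) !(row_mx0, mul0mx, mulmx0, mul1mx, mulmx1, add0r, addr0).
by rewrite !mul_row_col !mul0mx !add0r.
Qed.

Definition shift2 (t : nat * nat * nat) := (t.1.1.+2, t.1.2.+2, t.2.+2).

Lemma wranks_block i m (D : 'M[F]_i) C E (Z : 'M_m) :
  wranks i (block_mx D C E Z) =
    (\rank (block_mx D C E Z), \rank (row_mx E Z), \rank Z).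
Proof.
have PX : copid_mx i *m block_mx D C E Z = col_mx 0 (row_mx E Z).
  rewrite copid_block mulmx_block !(mul0mx, mul1mx, add0r).
  by rewrite block_mxEv row_mx0.
have PXP : col_mx (0 : 'M_(i, _)) (row_mx E Z) *m copid_mx i = col_mx 0 (row_mx 0 Z).
  rewrite copid_block mul_col_mx mul0mx mul_row_block.
  by rewrite !(mulmx0, mulmx1, add0r).
by rewrite /wranks PX PXP !rank_col_0mx rank_row_0mx.
Qed.

Lemma wranks_insert_skew i m (X : 'M[F]_(i + m)) :
  wranks i (insert_skew X) = shift2 (wranks i X).
Proof.
have rJ : \rank (skew_mx F 1) = 2 by rewrite mxrank_unit ?skew_mx_unit.
rewrite -{2}(submxK X) !wranks_block rank_insert rank_diag_block_mx rJ.
suff -> : \rank (row_mx (col_mx 0 (dlsubmx X)) (block_mx (skew_mx F 1) 0 0 (drsubmx X)))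
    = (\rank (skew_mx F 1) + \rank (row_mx (dlsubmx X) (drsubmx X)))%N by rewrite rJ.
(* With zero upper blocks, [rank_insert] computes the rank of the lower rows alone, which is the
   second invariant. *)
have := rank_insert (0 : 'M_(i, i)) 0 (dlsubmx X) (drsubmx X) (skew_mx F 1).
by rewrite !block_mxEv !row_mx0 !rank_col_0mx -block_mxEv.
Qed.

(** A change of basis of W splits the plane off the restriction of X to W; then the complement of W
    is changed to become orthogonal to that plane. *)
Lemma skew_reduce i m (X : 'M[F]_(i + (2 + m))) : X^T = - X -> drsubmx X != 0 ->
  exists2 X1 : 'M_(i + m), X1^T = - X1 & pcongr X (insert_skew X1).
Proof.
move=> skX Z0; have [_ _ skZ] := skew_blocks skX.
have [T Tu [Z1 skZ1 TZ]] := skew_split skZ Z0.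
have [Y [XY skY drY]] : exists Y : 'M_(i + (2 + m)),
    [/\ pcongr X Y, Y^T = - Y & drsubmx Y = block_mx (skew_mx F 1) 0 0 Z1].
  have XY := pcongr_lower X 0 (unitmx1 F i) Tu.
  exists ((block_mx 1%:M 0 0 T)^T *m X *m block_mx 1%:M 0 0 T).
  split; [exact: XY | exact: pcongr_skew XY skX | rewrite -TZ].
  rewrite -{1}(submxK X) tr_block_mx !mulmx_block block_mxKdr.
  by rewrite !trmx0 !(mul0mx, mulmx0, add0r).
pose J : 'M[F]_2 := skew_mx F 1.
have JT : J^T = - J by apply: (skew_mx_skew 1).
have JJ : J *m J = - 1%:M by apply: (skew_mx_sqr 1).
pose U1 := lsubmx (ursubmx Y); pose U2 := rsubmx (ursubmx Y).
(* The upper right block gains [B^T *m drsubmx Y], whose left part is U1 J J = - U1; this cancels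
   the pairing U1 of the complement with the plane. *)
pose B : 'M[F]_(2 + m, i) := col_mx (- (J *m U1^T)) 0.
have XW := pcongr_trans XY (pcongr_lower Y B (unitmx1 F i) (unitmx1 F (2 + m))).
move: XW; set W := _ *m _ => XW.
have drW : drsubmx W = block_mx J 0 0 Z1.
  rewrite /W -{1}(submxK Y) tr_block_mx !mulmx_block block_mxKdr.
  by rewrite !trmx0 !trmx1 !(mul0mx, mulmx0, mul1mx, mulmx1, add0r) drY.
have urW : ursubmx W = row_mx 0 U2.
  rewrite /W -{1}(submxK Y) tr_block_mx !mulmx_block block_mxKur drY.
  rewrite !trmx1 !(mul0mx, mulmx0, mul1mx, mulmx1, add0r).
  rewrite /B tr_col_mx linearN /= trmx_mul trmxK JT mulmxN opprK trmx0 mul_row_block.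
  rewrite -mulmxA JJ !(mul0mx, mulmx0, addr0) mulmxN mulmx1 -[ursubmx Y]hsubmxK.
  by rewrite add_row_mx addrN addr0.
have skW := pcongr_skew XW skX; have [skD dlW _] := skew_blocks skW.
exists (block_mx (ulsubmx W) U2 (- U2^T) Z1).
  by rewrite tr_block_mx opp_block_mx skD skZ1 opprK linearN /= trmxK.
suff -> : insert_skew (block_mx (ulsubmx W) U2 (- U2^T) Z1) = W by [].
rewrite /insert_skew block_mxKul block_mxKur block_mxKdl block_mxKdr.
rewrite -[RHS]submxK dlW urW drW; congr block_mx.
by rewrite tr_row_mx trmx0 opp_col_mx oppr0.
Qed.

(** * Completeness of the three ranks for i <= 2 *)

Lemma rank_equiv m n (A B : 'M[F]_(m, n)) : \rank A = \rank B ->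
  exists U V, [/\ U \in unitmx, V \in unitmx & U^T *m A *m V = B].
Proof.
move=> rAB; exists (col_ebase B *m invmx (col_ebase A))^T.
exists (invmx (row_ebase A) *m row_ebase B).
rewrite unitmx_tr !unitmx_mul !unitmx_inv !col_ebase_unit !row_ebase_unit.
split=> //; rewrite trmxK -{2}(mulmx_ebase A) -{3}(mulmx_ebase B) rAB.
rewrite -!mulmxA mulKmx ?col_ebase_unit //.
by rewrite mulKVmx ?row_ebase_unit.
Qed.

Lemma skew_small_congr i (A B : 'M[F]_i) : (i <= 2)%N ->
    A^T = - A -> B^T = - B -> \rank A = \rank B ->
  exists2 U, U \in unitmx & U^T *m A *m U = B.
Proof.
case: i A B => [|[|[|//]]] A B _ skA skB rAB;
  try by exists 1%:M; rewrite ?unitmx1 // (skew_small0 _ skA) //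
    (skew_small0 _ skB) // mulmx0 mul0mx.
have [A0 | A0] := eqVneq A 0; last first.
  by apply: skew2_congr => //; rewrite -mxrank_eq0 -rAB mxrank_eq0.
exists 1%:M; rewrite ?unitmx1 // A0 mulmx0 mul0mx.
by apply/esym/eqP; rewrite -mxrank_eq0 -rAB A0 mxrank0.
Qed.

(** The case of a totally isotropic W. If the pairing C' is 0, so is C, and the first rank decides
    between the forms D and D'. Otherwise C is first brought to C'; a change of complement by E then
    adds C' E - (C' E)^T to the upper left block and leaves C' alone, since the form vanishes on
    W. *)
Lemma pcongr_base i m (X Y : 'M[F]_(i + m)) : (i <= 2)%N ->
    X^T = - X -> Y^T = - Y -> drsubmx X = 0 -> drsubmx Y = 0 ->
  wranks i X = wranks i Y -> pcongr X Y.
Proof.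
move=> i2 skX skY X0 Y0.
have [skDX dlX _] := skew_blocks skX; have [skDY dlY _] := skew_blocks skY.
rewrite -(submxK X) -(submxK Y) dlX dlY X0 Y0.
move: (ulsubmx X) (ursubmx X) (ulsubmx Y) (ursubmx Y) skDX skDY => D C D' C' skD skD'.
rewrite !wranks_block => -[rX].
rewrite !rank_row_mx0 !mxrank_opp !mxrank_tr => rC.
have [C0 | C0] := eqVneq C' 0.
  have C00 : C = 0 by apply/eqP; rewrite -mxrank_eq0 rC C0 mxrank0.
  move: rX; rewrite C0 C00 trmx0 oppr0 !rank_diag_block_mx !mxrank0 !addn0 => rD.
  have [U Uu UD] := skew_small_congr i2 skD skD' rD.
  have := pcongr_lower (block_mx D 0 0 (0 : 'M_m)) 0 Uu (unitmx1 F m).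
  rewrite tr_block_mx !mulmx_block.
  by rewrite !trmx0 !(mul0mx, mulmx0, addr0, add0r) UD.
have [U [V [Uu Vu UCV]]] := rank_equiv rC.
have := pcongr_lower (block_mx D C (- C^T) 0) 0 Uu Vu.
rewrite tr_block_mx !mulmx_block !trmx0 !(mul0mx, mulmx0, addr0, add0r) UCV.
have -> : V^T *m - C^T *m U = - C'^T.
  by rewrite -UCV !trmx_mul trmxK mulmxN mulNmx mulmxA.
move/pcongr_trans; apply.
have skUD := skew_congr U skD.
have [|E DE] := @solve_skew_part i m C' (D' - U^T *m D *m U) i2 C0.
  by rewrite linearB /= skUD skD' opprB opprK addrC.
have := pcongr_lower (block_mx (U^T *m D *m U) C' (- C'^T) 0) E
  (unitmx1 F i) (unitmx1 F m).
rewrite tr_block_mx !mulmx_block !trmx0 !trmx1.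
rewrite !(mul0mx, mulmx0, mul1mx, mulmx1, addr0, add0r).
rewrite mulmxN -trmx_mul -addrA [- _ + _]addrC DE addrC subrK.
exact.
Qed.

Lemma wranks_complete i m (X Y : 'M[F]_(i + m)) : (i <= 2)%N ->
    X^T = - X -> Y^T = - Y -> wranks i X = wranks i Y -> pcongr X Y.
Proof.
move=> i2; elim/ltn_ind: m X Y => m IHm X Y skX skY eqr.
(* The third rank decides whether the form vanishes on W, so X and Y fall in the same case. If
   neither vanishes, a plane is split off both, and [shift2] is injective. *)
have eqZ : (drsubmx X == 0) = (drsubmx Y == 0).
  move: eqr; rewrite -{1}(submxK X) -{1}(submxK Y) !wranks_block => -[_ _ eqZ].
  by rewrite -!mxrank_eq0 eqZ.
have [X0 | X0] := eqVneq (drsubmx X) 0.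
  by apply: pcongr_base => //; apply/eqP; rewrite -eqZ X0.
have Y0 : drsubmx Y != 0 by rewrite -eqZ.
have [_ _ skZ] := skew_blocks skX.
case: m => [|[|m]] in IHm X Y skX skY eqr eqZ X0 Y0 skZ *;
  try by case/eqP: X0; apply: skew_small0 skZ.
have [X1 skX1 XX1] := skew_reduce skX X0; have [Y1 skY1 YY1] := skew_reduce skY Y0.
apply: (pcongr_trans XX1); apply: pcongr_trans (pcongr_sym YY1).
apply: insert_skew_pcongr; apply: IHm => //.
move: eqr; rewrite (wranks_pcongr XX1) (wranks_pcongr YY1) !wranks_insert_skew.
rewrite /shift2; move: (wranks i X1) (wranks i Y1).
by move=> [[? ?] ?] [[? ?] ?] /= [-> -> ->].
Qed.

End SkewForms.

(** * Rank triples of the representatives, and constraints on all triples *)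

Section Representatives.
Variable F : fieldType.

(** The truncated i - p makes this hold also for p >= i, where W contains the whole second summand.
    It makes the rank triples additive over diagonal blocks. *)
Lemma diag2_copid i p q :
  diag2 (copid_mx i) (copid_mx (i - p)) = copid_mx i :> 'M[F]_(p + q).
Proof.
rewrite /diag2 /copid_mx scalar_mx_block; apply/matrixP=> a b.
rewrite !mxE; case: splitP => a' ea; rewrite !mxE; case: splitP => b' eb;
  have := ltn_ord a'; have := ltn_ord b'; move=> lb la;
  rewrite !mxE ?ea ?eb //.
- by rewrite (_ : (a' == p + b' :> nat) = false) ?subr0 //; lia.
- by rewrite (_ : (p + a' == b' :> nat) = false) ?subr0 //; lia.
by rewrite eqn_add2l (_ : (p + a' < i)%N = (a' < i - p)%N) //; lia.
Qed.

Definition add_ranks (s t : nat * nat * nat) :=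
  (s.1.1 + t.1.1, s.1.2 + t.1.2, s.2 + t.2)%N.

Lemma wranks_diag2 i p q (X : 'M[F]_p) (Y : 'M_q) :
  wranks i (diag2 X Y) = add_ranks (wranks i X) (wranks (i - p) Y).
Proof.
rewrite /wranks -diag2_copid /diag2 !mulmx_block.
by rewrite !(mul0mx, mulmx0, addr0, add0r) !rank_diag_block_mx.
Qed.

Lemma wranks_mx0 i n : wranks i (0 : 'M[F]_n) = (0, 0, 0).
Proof. by rewrite /wranks mulmx0 mul0mx mxrank0. Qed.

Lemma wranks_0 n (X : 'M[F]_n) : wranks 0 X = (\rank X, \rank X, \rank X).
Proof. by rewrite /wranks /copid_mx pid_mx_0 subr0 mul1mx mulmx1. Qed.

Lemma wranks_ge i n (X : 'M[F]_n) : (n <= i)%N -> wranks i X = (\rank X, 0, 0).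
Proof.
move=> ni; suff P0 : copid_mx i = 0 :> 'M[F]_n by rewrite /wranks P0 !mul0mx mxrank0.
apply/matrixP=> a b; rewrite !mxE (leq_trans (ltn_ord a) ni) andbT.
exact: subrr.
Qed.

Lemma wranks_skew_mx m : wranks m (skew_mx F m) = (m + m, m, 0)%N.
Proof.
have rS : \rank (skew_mx F m) = (m + m)%N by rewrite mxrank_unit ?skew_mx_unit.
by rewrite -{2}rS wranks_block rank_row_mx0 mxrank_opp mxrank1 mxrank0.
Qed.

Lemma wranks_cast i m n (e : m = n) (X : 'M[F]_m) :
  wranks i (castmx (e, e) X) = wranks i X.
Proof. by case: _ / e; rewrite castmx_id. Qed.

Lemma calAS r : calA F r.+1
  = castmx (mxsize_recl, mxsize_recl) (diag2 (skew_mx F 1) (calA F r)).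
Proof. exact: mxdiag_recl. Qed.

Lemma wranks_calAS i r :
  wranks i (calA F r.+1)
    = add_ranks (wranks i (skew_mx F 1)) (wranks (i - 2) (calA F r)).
Proof. by rewrite calAS wranks_cast wranks_diag2. Qed.

Lemma rank_calA r : \rank (calA F r) = (2 * r)%N.
Proof.
rewrite rank_mxdiag (eq_bigr (fun=> 2)); last first.
  by move=> k _; apply: mxrank_unit (skew_mx_unit _ 1).
by rewrite sum_nat_const card_ord mulnC.
Qed.

Lemma wranks_calA1 r : wranks 1 (calA F r.+1) = (2 * r.+1, (2 * r).+1, 2 * r)%N.
Proof.
rewrite wranks_calAS wranks_skew_mx wranks_0 rank_calA /add_ranks /=.
by congr (_, _, _); lia.
Qed.

Lemma wranks_calA2 r : wranks 2 (calA F r.+1) = (2 * r.+1, 2 * r, 2 * r)%N.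
Proof.
rewrite wranks_calAS wranks_ge // wranks_0 rank_calA /add_ranks /=.
rewrite mxrank_unit ?skew_mx_unit //.
by congr (_, _, _); lia.
Qed.

Lemma wranks_conform i m n (X : 'M[F]_m) : m = n ->
  wranks i (conform_mx (0 : 'M_n) X) = wranks i X.
Proof. by move=> e; case: _ / e; rewrite conform_mx_id. Qed.

Lemma wranks_repA i nu r : (2 * r <= nu)%N ->
  wranks i (repA F nu r) = wranks i (calA F r).
Proof.
move=> rnu; rewrite wranks_conform ?sum_nat_const ?card_ord; last lia.
rewrite wranks_diag2 wranks_mx0 /add_ranks !addn0.
by case: (wranks _ _) => [[]].
Qed.

Lemma wranks_repZ i p nu r : (p + 2 * r <= nu)%N ->
  wranks i (repZ F p nu r) = wranks (i - p) (calA F r).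
Proof.
move=> rnu; rewrite wranks_conform ?sum_nat_const ?card_ord; last lia.
rewrite !wranks_diag2 !wranks_mx0 /add_ranks !addn0 !add0n.
by case: (wranks _ _) => [[]].
Qed.

Lemma wranks_repK nu r : (2 * r.+2 <= nu)%N ->
  wranks 2 (repK F nu r.+2) = (2 * r.+2, (2 * r).+2, 2 * r)%N.
Proof.
move=> rnu; rewrite wranks_conform ?sum_nat_const ?card_ord; last lia.
rewrite !wranks_diag2 wranks_skew_mx !wranks_0 subn2 /= rank_calA /add_ranks /= mxrank0.
by congr (_, _, _); lia.
Qed.

Lemma diag2_skew p q (X : 'M[F]_p) (Y : 'M_q) : X^T = - X -> Y^T = - Y ->
  (diag2 X Y)^T = - diag2 X Y.
Proof.
by move=> sX sY; rewrite /diag2 tr_block_mx sX sY opp_block_mx !trmx0 !oppr0.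
Qed.

Lemma mx0_skew n : (0 : 'M[F]_n)^T = - 0.
Proof. by rewrite trmx0 oppr0. Qed.

Lemma conform_skew m n (X : 'M[F]_m) : X^T = - X ->
  (conform_mx (0 : 'M_n) X)^T = - conform_mx 0 X.
Proof.
have [e | ne] := eqVneq m n; first by case: _ / e; rewrite conform_mx_id.
(* For different sizes [conform_mx] returns its default 0, which is alternate too. *)
by rewrite nonconform_mx ?ne // trmx0 oppr0.
Qed.

Lemma calA_skew r : (calA F r)^T = - calA F r.
Proof.
elim: r => [|r IHr].
  by apply/matrixP=> a; have := ltn_ord a; rewrite [X in (_ < X)%N]big_ord0.
by rewrite calAS; apply: cast_skew; apply: diag2_skew (skew_mx_skew F 1) IHr.
Qed.

(** The complement of P is [pid_mx i], of rank at most i, so deleting the first i rows or columns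
    lowers a rank by at most i. *)
Lemma wranks_bounds i n (X : 'M[F]_n) : (i <= n)%N -> X^T = - X ->
  let: (a, b, c) := wranks i X in
  [/\ (c <= b <= c + i)%N, (b <= a <= b + i)%N, (b <= n - i)%N & a = b -> c = a].
Proof.
move=> i_n skX; rewrite /wranks; set P := copid_mx i.
have P1 : pid_mx i + P = 1%:M by rewrite addrC subrK.
have rpid : (\rank (pid_mx i : 'M[F]_n) <= i)%N by rewrite rank_pid_mx.
split.
- rewrite mxrankM_maxl /= -{1}[P *m X]mulmx1 -P1 mulmxDr.
  apply: leq_trans (mxrank_add _ _) _; rewrite addnC leq_add2l.
  exact: leq_trans (mxrankM_maxr _ _) rpid.
- rewrite mxrankM_maxr /= -{1}[X]mul1mx -P1 mulmxDl.
  apply: leq_trans (mxrank_add _ _) _; rewrite addnC leq_add2l.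
  exact: leq_trans (mxrankM_maxl _ _) rpid.
- by rewrite -(rank_copid_mx F i_n) mxrankM_maxl.
move=> rX; apply/eqP; rewrite eqn_leq; apply/andP; split.
  by apply: leq_trans (mxrankM_maxl _ _) _; rewrite mxrankM_maxr.
(* Equal ranks make the row spaces of X and P X equal, so X = Q P X. Transposing gives X = X P Q^T,
   whence X = Q (P X P) Q^T has rank at most that of P X P. *)
have /submxP[Q XQ] : (X <= P *m X)%MS.
  by have := (mxrank_leqif_eq (submxMl P X)).2; rewrite -rX eqxx => /esym/andP[].
have XQ' : X = X *m P *m Q^T.
  have := congr1 trmx XQ; rewrite !trmx_mul skX tr_copid_mx => /(congr1 -%R).
  by rewrite !mulNmx !opprK.
rewrite {1}XQ {1}XQ' !mulmxA; apply: leq_trans (mxrankM_maxl _ _) _.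
by rewrite -!mulmxA; apply: mxrankM_maxr.
Qed.
End Representatives.

(** * Orbits over a finite field of odd order *)

(** By Lagrange in the additive group the order of F is 0 in F; if 2 were 0 there, an odd order
    would equal 1. *)
Lemma odd_card_two_neq0 (F : finFieldType) : odd #|F| -> 2%:R != 0 :> F.
Proof.
move=> oddF; have : (#|F|%:R == 0 :> F).
  by have := expg_cardG (in_setT (1 : F)); rewrite cardsT => /eqP.
apply: contraTneq => F2; rewrite -[#|F|]odd_double_half oddF natrD -muln2 natrM.
by rewrite F2 mulr0 addr0 oner_eq0.
Qed.

Section Orbits.
Variables (F : finFieldType) (i n : nat) (le_i_n : (i <= n.+1)%N).
Hypothesis oddF : odd #|F|.
Hypothesis i2 : (i <= 2)%N.
Let to_block (X : 'M[F]_n.+1) : 'M_(i + (n.+1 - i)) :=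
  castmx (esym (subnKC le_i_n), esym (subnKC le_i_n)) X.
Let orb (X : 'M[F]_n.+1) := orbit (congr_action F n) (O_ F le_i_n) X.

Lemma orbit_pcongr X Y : Y \in orb X <-> pcongr (to_block X) (to_block Y).
Proof.
split=> [/orbitP[g] | [T [Tu T0 TXY]]].
  rewrite inE => /existsP[A /existsP[B /existsP[C /and3P[Au Cu /eqP gE]]]] <-.
  exists (block_mx A 0 B C); split; rewrite ?block_mxKur //.
    by rewrite lower_unit ?block_mxKul ?block_mxKdr ?block_mxKur ?Au.
  by rewrite /to_block /= /congr_mx gE /lower_block cast_congr.
have gu : castmx (subnKC le_i_n, subnKC le_i_n) T \is a GRing.unit.
  by rewrite -[X in is_true X]/(_ \in unitmx) cast_unit.
apply/orbitP; exists (FinRing.Unit gu); rewrite ?inE /=.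
  apply/existsP; exists (ulsubmx T); apply/existsP; exists (dlsubmx T).
  apply/existsP; exists (drsubmx T).
  by rewrite andbA -lower_unit // Tu /lower_block -T0 submxK eqxx.
apply: (can_inj (castmxKV (subnKC le_i_n) (subnKC le_i_n))).
rewrite -[RHS]TXY /congr_mx.
exact: cast_congr.
Qed.

Lemma orbit_wranks X Y : Y \in orb X -> wranks i X = wranks i Y.
Proof. by move/orbit_pcongr/wranks_pcongr; rewrite !wranks_cast. Qed.

Lemma wranks_orbit X Y : X^T = - X -> Y^T = - Y ->
  wranks i X = wranks i Y -> Y \in orb X.
Proof.
move=> skX skY eqr; apply/orbit_pcongr/wranks_complete; rewrite ?wranks_cast //.
- exact: odd_card_two_neq0.
- exact: cast_skew.
exact: cast_skew.
Qed.

(** Alternate matrices are in one orbit exactly when their triples agree. Hence a list of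
    representatives needs only distinct triples that exhaust those of nonzero alternate matrices. *)
Lemma orbit_classification (reps : seq 'M[F]_n.+1) :
    {in reps, forall M, M^T = - M} -> uniq [seq wranks i M | M <- reps] ->
    (forall X : 'M[F]_n.+1, X^T = - X -> X != 0 ->
       wranks i X \in [seq wranks i M | M <- reps]) ->
  orb 0 = [set 0] /\
  (forall X : 'M[F]_n.+1, X \in alternate_mxs F n.+1 -> X != 0 ->
    exists! M : 'M[F]_n.+1, M \in reps /\ X \in orb M) /\
  uniq [seq orb M | M <- reps].
Proof.
move=> skR uR exR; have injR := uniq_map_inj_in uR; split; [|split].
- apply/setP=> X; rewrite inE; apply/orbitP/eqP => [[g _ <-] | ->].
    by rewrite /= /congr_mx mulmx0 mul0mx.
  by exists 1%g; rewrite ?group1 // /= /congr_mx mulmx0 mul0mx.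
- move=> X; rewrite inE => /eqP skX X0.
  have /mapP[M MR eqM] := exR X skX X0.
  exists M; split; first by split=> //; apply: wranks_orbit => //; apply: skR.
  by move=> M' [M'R /orbit_wranks eqM']; apply: injR; rewrite // eqM' -eqM.
rewrite map_inj_in_uniq ?(map_uniq uR) // => M M' MR M'R eqo.
apply: injR => //; apply: orbit_wranks.
by have -> : orb M = orb M' := eqo; apply: orbit_refl.
Qed.

End Orbits.

(** * Arithmetic of the rank triples *)

Section RepresentativeRanks.
Variables (F : finFieldType) (n : nat).
Hypothesis two_neq0 : 2%:R != 0 :> F.

(** The four ways a form of rank 2r can sit relative to W. For i = 1, [ranks0] and [ranks1] belong
    to [repZ 1] and [repA]; for i = 2, [ranks0], [ranks1], [ranks2] and [ranks4] belong to [repZ 2],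
    [repZ 1], [repA] and [repK]. *)
Definition ranks0 r := (2 * r, 2 * r, 2 * r)%N.
Definition ranks1 r := (2 * r, 2 * r - 1, 2 * r - 2)%N.
Definition ranks2 r := (2 * r, 2 * r - 2, 2 * r - 2)%N.
Definition ranks4 r := (2 * r, 2 * r - 2, 2 * r - 4)%N.

Lemma wranks_reps1 : [seq wranks 1 M | M <- reps1 F n.+1] =
  [seq ranks0 r | r <- index_iota 1 ((n.+1 - 1) %/ 2).+1] ++
  [seq ranks1 r | r <- index_iota 1 (n.+1 %/ 2).+1].
Proof.
rewrite /reps1 map_cat -!map_comp; congr (_ ++ _); apply/eq_in_map => r /=;
  rewrite mem_index_iota => /andP[r_gt0 r_le].
- by rewrite wranks_repZ ?wranks_0 ?rank_calA //; lia.
rewrite wranks_repA; last lia.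
case: r r_gt0 r_le => // r _ _; rewrite wranks_calA1 /ranks1.
by congr (_, _, _); lia.
Qed.

Lemma wranks_reps2 : (1 < n.+1)%N -> [seq wranks 2 M | M <- reps2 F n.+1] =
  [seq ranks1 r | r <- index_iota 1 ((n.+1 - 1) %/ 2).+1] ++
  [seq ranks0 r | r <- index_iota 1 ((n.+1 - 2) %/ 2).+1] ++
  [seq ranks2 r | r <- index_iota 1 (n.+1 %/ 2).+1] ++
  [seq ranks4 r | r <- index_iota 2 (n.+1 %/ 2).+1].
Proof.
move=> n_gt0; rewrite /reps2 !map_cat -!map_comp.
congr (_ ++ (_ ++ (_ ++ _))); apply/eq_in_map => r /=;
  rewrite mem_index_iota => /andP[r_gt0 r_le].
- rewrite wranks_repZ; last lia.
  case: r r_gt0 r_le => // r _ _; rewrite wranks_calA1 /ranks1.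
  by congr (_, _, _); lia.
- by rewrite wranks_repZ ?wranks_0 ?rank_calA //; lia.
- rewrite wranks_repA; last lia.
  case: r r_gt0 r_le => // r _ _; rewrite wranks_calA2 /ranks2.
  by congr (_, _, _); lia.
case: r r_gt0 r_le => [|[|r]] // _ r_le; rewrite wranks_repK; last lia.
by rewrite /ranks4; congr (_, _, _); lia.
Qed.

Lemma reps1_skew : {in reps1 F n.+1, forall M, M^T = - M}.
Proof.
have skA := calA_skew F; have sk0 := mx0_skew F.
move=> M; rewrite mem_cat => /orP[] /mapP[r _ ->]; apply: conform_skew;
  by do ![apply: diag2_skew => // | exact: sk0 | exact: skA].
Qed.

Lemma reps2_skew : {in reps2 F n.+1, forall M, M^T = - M}.
Proof.
have skA := calA_skew F; have sk0 := mx0_skew F; have skK := skew_mx_skew F.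
by move=> M; rewrite !mem_cat => /or4P[] /mapP[r _ ->]; apply: conform_skew;
  do ![apply: diag2_skew => // | exact: sk0 | exact: skA | exact: skK].
Qed.

(** P is symmetric, so P X P is a congruence transform of X and is alternate: the first and third
    ranks are even. Writing them 2a and 2c leaves a problem of linear arithmetic. *)
Lemma skew_wranks i (X : 'M[F]_n.+1) : (i <= n.+1)%N -> X^T = - X -> X != 0 ->
  exists a b c, [/\ wranks i X = (2 * a, b, 2 * c)%N, (0 < a)%N & (2 * a <= n.+1)%N]
    /\ [/\ (2 * c <= b <= 2 * c + i)%N, (b <= 2 * a <= b + i)%N,
           (b <= n.+1 - i)%N & 2 * a = b -> c = a]%N.
Proof.
move=> i_n skX X0; have := wranks_bounds i_n skX.
have evX := skew_rank_even two_neq0 skX.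
have := skew_rank_even two_neq0 (skew_congr (copid_mx i) skX).
rewrite tr_copid_mx /wranks => evPXP [c_b b_a b_n abc].
exists (\rank X)./2, (\rank (copid_mx i *m X)).
exists (\rank (copid_mx i *m X *m copid_mx i))./2.
rewrite !mul2n !even_halfK //; do !split => //; last by move=> /abc ->.
  by move: X0 evX; rewrite half_gt0 -mxrank_eq0; case: (\rank X) => [|[]].
exact: rank_leq_row.
Qed.

Lemma wranks_reps1_cover (X : 'M[F]_n.+1) : X^T = - X -> X != 0 ->
  wranks 1 X \in [seq wranks 1 M | M <- reps1 F n.+1].
Proof.
move=> skX X0; rewrite wranks_reps1 mem_cat.
have [a [b [c [[-> a0 an] [cb ba bn abc]]]]] := skew_wranks (ltn0Sn n) skX X0.
(* Here b is 2c or 2c + 1 and 2a is b or b + 1, so parity forces 2a = 2c or 2a = 2c + 2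
   respectively. *)
apply/orP; have [bc|bc] := eqVneq b (2 * c)%N; [left|right];
  apply/mapP; exists a; rewrite ?mem_index_iota; try lia;
  by rewrite /ranks0 /ranks1; congr (_, _, _); lia.
Qed.

Lemma wranks_reps2_cover (X : 'M[F]_n.+1) : (1 < n.+1)%N -> X^T = - X -> X != 0 ->
  wranks 2 X \in [seq wranks 2 M | M <- reps2 F n.+1].
Proof.
move=> n_gt0 skX X0; rewrite wranks_reps2 // !mem_cat.
have [a [b [c [[-> a0 an] [cb ba bn abc]]]]] := skew_wranks n_gt0 skX X0.
(* If b = 2a, all three ranks agree. Otherwise b = 2c or 2c + 1 forces a = c + 1, and b = 2c + 2
   forces a = c + 2. The bound b <= n.+1 - 2 supplies the upper limits on r in the families
   [repZ]. *)
have [Ea|Na] := eqVneq b (2 * a)%N.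
  apply/or4P/Or42/mapP; exists a; rewrite ?mem_index_iota; first lia.
  by rewrite /ranks0; congr (_, _, _); lia.
have [b1|b1] := eqVneq b (2 * c).+1.
  apply/or4P/Or41/mapP; exists a; rewrite ?mem_index_iota; first lia.
  by rewrite /ranks1; congr (_, _, _); lia.
have [b2|b2] := eqVneq b (2 * c)%N.
  apply/or4P/Or43/mapP; exists a; rewrite ?mem_index_iota; first lia.
  by rewrite /ranks2; congr (_, _, _); lia.
apply/or4P/Or44/mapP; exists a; rewrite ?mem_index_iota; first lia.
by rewrite /ranks4; congr (_, _, _); lia.
Qed.

Lemma wranks_reps1_uniq : uniq [seq wranks 1 M | M <- reps1 F n.+1].
Proof.
rewrite wranks_reps1 cat_uniq; apply/and3P; split.
- by rewrite map_inj_uniq ?iota_uniq // => r r' []; lia.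
- apply/hasPn => _ /mapP[r + ->]; rewrite mem_index_iota => r_in.
  by apply/mapP => -[r' _ []]; lia.
by rewrite map_inj_uniq ?iota_uniq // => r r' []; lia.
Qed.

Lemma wranks_reps2_uniq : (1 < n.+1)%N -> uniq [seq wranks 2 M | M <- reps2 F n.+1].
Proof.
move=> n_gt0; rewrite wranks_reps2 // !cat_uniq.
(* Within a family the first rank 2r determines r. Across families the differences of the ranks
   disagree, the lower bounds on r keeping the natural subtractions from truncating. *)
rewrite !map_inj_uniq ?iota_uniq; try by move=> r r' []; lia.
rewrite /= andbT; apply/and3P; split; apply/hasPn => t; rewrite ?mem_cat.
- by case/or3P=> /mapP[r + ->]; rewrite mem_index_iota => r_in;
    apply/mapP => -[r' + []]; rewrite mem_index_iota; lia.
- by case/orP=> /mapP[r + ->]; rewrite mem_index_iota => r_in;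
    apply/mapP => -[r' + []]; rewrite mem_index_iota; lia.
by case/mapP=> r + ->; rewrite mem_index_iota => r_in;
    apply/mapP => -[r' + []]; rewrite mem_index_iota; lia.
Qed.

End RepresentativeRanks.

Theorem theorem2p1 (F : finFieldType) (oddF : odd #|F|) (n : nat) :
  (forall i1 : (1 <= n.+1)%N,
     orbit (congr_action F n) (O_ F i1) 0 = [set 0] /\
     (forall X : 'M[F]_n.+1, X \in alternate_mxs F n.+1 -> X != 0 ->
        exists! M : 'M[F]_n.+1,
          M \in reps1 F n.+1 /\
          X \in orbit (congr_action F n) (O_ F i1) M) /\
     uniq [seq orbit (congr_action F n) (O_ F i1) M | M <- reps1 F n.+1])
  /\
  (forall i2 : (2 <= n.+1)%N,
     orbit (congr_action F n) (O_ F i2) 0 = [set 0] /\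
     (forall X : 'M[F]_n.+1, X \in alternate_mxs F n.+1 -> X != 0 ->
        exists! M : 'M[F]_n.+1,
          M \in reps2 F n.+1 /\
          X \in orbit (congr_action F n) (O_ F i2) M) /\
     uniq [seq orbit (congr_action F n) (O_ F i2) M | M <- reps2 F n.+1]).
Proof.
have two_neq0 := odd_card_two_neq0 oddF.
split=> [i1 | i2]; apply: orbit_classification => //.
- exact: reps1_skew.
- exact: wranks_reps1_uniq.
- by move=> X; apply: wranks_reps1_cover.
- exact: reps2_skew.
- exact: wranks_reps2_uniq.
by move=> X; apply: wranks_reps2_cover.
Qed.
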